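(* Let $H$ be a real Hilbert space and let $\{\phi_t;\ t\ge0\}$ be a family of closed convex functions from $H$ to $\mathbb R\cup\{+\infty\}$. Assume that: (H1) There exists a closed proper convex function $\phi_\infty:H\to\mathbb R\cup\{+\infty\}$ such that the set $S_\infty=\mathrm{argmin}\,\phi_\infty$ is nonempty and bounded. (H2) $\phi_\infty(x_\infty)\le\liminf_{k\to+\infty}\phi_{t_k}(x_k)$ for all convergent sequences $x_k\to x_\infty$ (strongly in $H$) and $t_k\to+\infty$. (H3) $\lim_{t\to+\infty}v_\infty(t)=\min_H\phi_\infty$, where $v_\infty(t)=\sup_{z\in S_\infty}\phi_t(z)$. (H4) For $t$ large enough, all functions $\phi_t$ are uniformly minorized by a function $f:H\to\mathbb R\cup\{-\infty,+\infty\}$ such that, for every $R>0$ and $l\in\mathbb R$, the set $\{x\in H:\ \|x\|\le R,\ f(x)\le l\}$ is relatively compact in $H$. Let $x(\cdot)$ be a strong global solution of $$\dot x(t)+\partial\phi_t(x(t))\ni0,\qquad t\ge0.$$ Then: (i) $\lim_{t\to+\infty}d(x(t),S_\infty)=0$. (ii) If moreover $$\forall z\in S_\infty,\qquad\int_0^{+\infty}G_{\partial\phi_t}(z,0)\,dt<+\infty,$$ then there exists $x_\infty\in S_\infty$ such that $x(t)\rightharpoonup x_\infty$ weakly in $H$ as $t\to+\infty$.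
   Context: $H$ is a real Hilbert space with scalar product $\langle\cdot,\cdot\rangle$ and norm $\|\cdot\|$; $d(x,S)=\inf_{z\in S}\|x-z\|$. ''Closed'' means lower semicontinuous. The subdifferential is $\partial f(x)=\{p\in H: f(y)\ge f(x)+\langle p,y-x\rangle\ \forall y\in H\}$ for $x$ with $f(x)<+\infty$ (empty otherwise). (H4) means: there exist $t_0\ge0$ and such an $f$ with $\phi_t\ge f$ on $H$ for all $t\ge t_0$. For a maximal monotone operator $M:H\rightrightarrows H$, the Brézis–Haraux function is $G_M(x,u)=\sup_{(y,v)\in\mathrm{gph}\,M}\langle x-y,v-u\rangle$, where $\mathrm{gph}\,M=\{(y,v):v\in My\}$. A strong global solution is a function $x:[0,+\infty[\to H$, absolutely continuous on every bounded interval $[0,T]$, satisfying the inclusion for almost every $t>0$. *)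

(* Defs.v *)
From HB Require Import structures.
From mathcomp Require Import all_boot all_order all_algebra.
From mathcomp Require Import all_classical all_reals all_analysis.
Set Implicit Arguments.
Unset Strict Implicit.
Unset Printing Implicit Defensive.
Import Order.TTheory GRing.Theory Num.Theory.
Import numFieldNormedType.Exports.
Local Open Scope classical_set_scope.
Local Open Scope ring_scope.
Local Open Scope ereal_scope.

(* A real Hilbert space is a complete normed module [H] over [R : realType]
   together with [ip : {dot H for idfun}], a symmetric positive definite
   bilinear form, that induces the norm of [H]. *)
Definition induces_norm (R : realType) (H : completeNormedModType R)
    (ip : {dot H for (@idfun R)}) : Prop :=
  forall x : H, (`|x| = Num.sqrt (ip x x))%R.

Section ExtendedRealFunctions.
Context {R : realType} {H : completeNormedModType R}.
Implicit Types f : H -> \bar R.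

(* For functions avoiding -oo the right-hand side is never of the
   form +oo - oo. *)
Definition econvex f : Prop :=
  forall (x y : H) (s : R), (0 < s < 1)%R ->
    f (s *: x + (1 - s) *: y)%R <= s%:E * f x + (1 - s)%:E * f y.

Definition closed_convex f : Prop :=
  [/\ forall x, f x != -oo, lower_semicontinuous f & econvex f].

Definition eproper f : Prop := exists x, f x < +oo.

Definition argmin f : set H := [set z | forall y, f z <= f y].

Definition dist_set (x : H) (S : set H) : R :=
  inf [set `|x - z|%R | z in S].

End ExtendedRealFunctions.

Section Hilbert.
Context {R : realType} {H : completeNormedModType R}.
Variable ip : {dot H for (@idfun R)}.

Definition subdifferential (f : H -> \bar R) (x : H) : set H :=
  [set p | f x < +oo /\ forall y, f x + (ip p (y - x)%R)%:E <= f y].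

(* A set-valued operator [H => H] is encoded as a function [H -> set H]. *)
Definition gph (M : H -> set H) : set (H * H) := [set yv | M yv.1 yv.2].

Definition brezis_haraux (M : H -> set H) (x u : H) : \bar R :=
  ereal_sup [set (ip (x - yv.1)%R (yv.2 - u)%R)%:E | yv in gph M].

Definition absolutely_continuous_on (a b : R) (x : R -> H) : Prop :=
  forall e : R, (0 < e)%R -> exists2 d : R, (0 < d)%R &
    forall (n : nat) (u v : 'I_n -> R),
      (forall i, [/\ a <= u i, u i <= v i & v i <= b]%R) ->
      trivIset [set: 'I_n] (fun i => `]u i, v i[%classic) ->
      (\sum_(i < n) (v i - u i) < d)%R ->
      (\sum_(i < n) `|x (v i) - x (u i)| < e)%R.

(* Only the values of [x] and [phi] at times [t >= 0] matter. *)
Definition strong_global_solution (phi : R -> H -> \bar R) (x : R -> H)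
    : Prop :=
  (forall T : R, (0 <= T)%R -> absolutely_continuous_on 0 T x) /\
  {ae (@lebesgue_measure R), forall t : R, (0 < t)%R ->
     derivable x t 1 /\ subdifferential (phi t) (x t) (- derive1 x t)%R}.

Definition weakly_cvg_pinfty (x : R -> H) (l : H) : Prop :=
  forall y : H, (ip (x t) y @[t --> +oo%R] --> ip l y)%R.

End Hilbert.

(* Main.v *)
Require Import Defs.
From HB Require Import structures.
From mathcomp Require Import all_boot all_order all_algebra.
From mathcomp Require Import all_classical all_reals all_analysis.
From mathcomp Require Import measurable_realfun.
From mathcomp Require Import ring lra.
Import Order.TTheory GRing.Theory Num.Theory.
Import numFieldNormedType.Exports.
Local Open Scope classical_set_scope.
Local Open Scope ring_scope.
Local Open Scope ereal_scope.

(** Write [S] for the set of minimizers of [phi_inf] and [v t] for the supremum of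
    [phi t] over [S].

    The hypotheses force a uniform gap: for every [e > 0] there is [d > 0] such
    that, for all large [t], [phi t >= v t + d] at all points at distance at least
    [e] from [S] ([uniform_gap]). In a ball this is a compactness argument, in which
    the common minorant of the functions gives strongly convergent subsequences
    and the lower limit inequality puts their limits into [S] ([argmin_cluster]);
    convexity carries the gap outside the ball ([econvex_separation]).

    Where the trajectory is at distance at least [e] from [S], the subgradient
    inequality tested at the points of [S] bounds the slope of the squared distance
    to [S] by [- 2 * d] ([slope_dist_set]). So this distance eventually falls below
    [e] and remains there ([dist_set_cvg0]), which is the first assertion.

    For the second one, let [z] be in [S]. Half the derivative of
    [`|x t - z| ^+ 2] is at most the Brezis-Haraux function at [(z, 0)], so that
    [`|x t - z| ^+ 2] is nonincreasing up to increments of a bounded primitive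
    ([distance_almost_nonincreasing]). Here the Brezis-Haraux function is
    nonnegative at almost every time, by the existence of proximal points
    ([proximal_point]), so that its integral dominates the one of the positive part
    of the derivative. The compactness
    argument also shows that the trajectory, which approaches [S], has an
    accumulation point [p] in norm that belongs to [S] ([trajectory_cluster]).
    Taking [z := p], the distance to [p] comes close to 0 at arbitrarily large times
    and almost decreases, hence it tends to 0: the convergence even holds in norm.

    Passing from slopes at almost every time to monotonicity rests on
    [nonincreasing_of_slope], a substitute for the fundamental theorem of calculus
    for absolutely continuous functions. *)

(** * Inner product *)

Section InnerProduct.
Set Implicit Arguments.
Unset Strict Implicit.
Local Open Scope ring_scope.
Context {R : realType} {H : completeNormedModType R}.
Variable ip : {dot H for (@idfun R)}.
Implicit Types u v w : H.

Lemma ipC u v : ip u v = ip v u.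
Proof. by rewrite hermC expr0 mul1r. Qed.

Lemma ipDr u v w : ip u (v + w) = ip u v + ip u w.
Proof. exact: linearDr. Qed.

Lemma ipNr u v : ip u (- v) = - ip u v.
Proof. exact: linearNr. Qed.

Lemma ipZr (s : R) u v : ip u (s *: v) = s * ip u v.
Proof. exact: linearZr. Qed.

Lemma ipDl u v w : ip (v + w) u = ip v u + ip w u.
Proof. by rewrite ipC ipDr !(ipC u). Qed.

Lemma ipNl u v : ip (- v) u = - ip v u.
Proof. by rewrite ipC ipNr ipC. Qed.

Lemma ipZl (s : R) u v : ip (s *: v) u = s * ip v u.
Proof. by rewrite ipC ipZr ipC. Qed.

Lemma ip0r u : ip u 0 = 0.
Proof. exact: linear0r. Qed.

Lemma ip0l u : ip 0 u = 0.
Proof. by rewrite ipC ip0r. Qed.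

Definition ipE := (ipDl, ipDr, ipNl, ipNr, ipZl, ipZr).

Hypothesis hH : induces_norm ip.

Lemma ip_norm u : ip u u = `|u| ^+ 2.
Proof.
rewrite hH sqr_sqrtr//; have [->|u0] := eqVneq u 0.
  by rewrite ip0l.
exact/ltW/neq0_dnorm_gt0.
Qed.

Lemma normD_sqr u v : `|u + v| ^+ 2 = `|u| ^+ 2 + 2 * ip u v + `|v| ^+ 2.
Proof. by rewrite -!ip_norm !ipE (ipC v u); ring. Qed.

Lemma sqr_normB u v : `|u - v| ^+ 2 = `|u| ^+ 2 - 2 * ip u v + `|v| ^+ 2.
Proof. by rewrite -!ip_norm !ipE (ipC v u); ring. Qed.

Lemma cauchy_schwarz u v : ip u v <= `|u| * `|v|.
Proof.
have [->|u0] := eqVneq u 0.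
  by rewrite normr0 mul0r ip0l.
have [->|v0] := eqVneq v 0.
  by rewrite normr0 mulr0 ip0r.
have uv : 0 < `|u| * `|v| by rewrite mulr_gt0// normr_gt0.
rewrite -(ler_pM2l uv).
(* Expand the norm of the vector that vanishes when equality holds. *)
have := sqr_ge0 `| `|v| *: u - `|u| *: v |.
by rewrite sqr_normB !normrZ !normr_id !ipE; nra.
Qed.

Lemma cauchy_schwarz_norm u v : `|ip u v| <= `|u| * `|v|.
Proof.
rewrite ler_norml cauchy_schwarz andbT lerNl -ipNl.
by rewrite (le_trans (cauchy_schwarz _ _))// normrN.
Qed.

(** Polarization expresses the form by norms, which are continuous. *)
Lemma cvg_ip {T : Type} (F : set_system T) {FF : Filter F}
    (f g : T -> H) (a b : H) :
  f @ F --> a -> g @ F --> b -> ip (f t) (g t) @[t --> F] --> ip a b.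
Proof.
have polar p q : ip p q = 4^-1 * (`|p + q| ^+ 2 - `|p - q| ^+ 2).
  by rewrite (normD_sqr p) (sqr_normB p); field.
move=> fa gb; rewrite polar; under eq_fun do rewrite polar.
apply: cvgMr; rewrite !expr2; under eq_fun do rewrite !expr2.
by apply: cvgB; apply: cvgM; apply: cvg_norm; [apply: cvgD|apply: cvgD|
  apply: cvgB|apply: cvgB].
Qed.

End InnerProduct.

(** * Functions of nonpositive slope almost everywhere *)

Section Growth.
Set Implicit Arguments.
Unset Strict Implicit.
Local Open Scope ring_scope.
Context {R : realType} {H : completeNormedModType R}.
Implicit Types (G : R -> R) (x : R -> H).
Local Notation mu := (@lebesgue_measure R).

(** Multiplying the increment by [s - t] lets one inequality bound the difference
    quotients on both sides of [t]. *)
Definition slope_le G (t c : R) := forall e : R, 0 < e ->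
  \forall s \near t, (s - t) * (G s - G t) <= (c + e) * (s - t) ^+ 2.

(** Families of disjoint intervals are built from left to right below, and each
    new interval is put at the head of the list. *)
Definition right_to_left (l : seq (R * R)) :=
  pairwise (fun p q : R * R => q.2 <= p.1) l.

Definition within_itv (a b : R) (l : seq (R * R)) :=
  all (fun p : R * R => (a <= p.1 <= p.2) && (p.2 <= b)) l.

Lemma absolutely_continuous_on_seq (a b : R) x :
  absolutely_continuous_on a b x -> forall e : R, 0 < e -> exists2 d, 0 < d &
    forall l, within_itv a b l -> right_to_left l ->
      \sum_(p <- l) (p.2 - p.1) < d -> \sum_(p <- l) `|x p.2 - x p.1| < e.
Proof.
move=> acx e e0; have [d d0 hd] := acx _ e0; exists d => // l lab rl ld.
have sl (F : R * R -> R) :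
    \sum_(p <- l) F p = \sum_(i < size l) F (nth (0, 0) l i).
  by rewrite (big_nth (0, 0)) big_mkord.
rewrite sl; rewrite sl in ld.
apply: (hd (size l) (fun i => (nth (0, 0) l i).1)
                    (fun i => (nth (0, 0) l i).2)) => //.
  move=> i; have /allP/(_ (nth (0, 0) l i)) := lab.
  by rewrite mem_nth// => /(_ isT)/andP[/andP[-> ->] ->].
have disj (i j : 'I_(size l)) r : (i < j)%N ->
    `](nth (0, 0) l i).1, (nth (0, 0) l i).2[%classic r ->
    `](nth (0, 0) l j).1, (nth (0, 0) l j).2[%classic r -> False.
  move=> ij; rewrite /= !in_itv/= => /andP[h1 _] /andP[_ h2].
  have /(pairwiseP (0, 0))/(_ i j) := rl.
  rewrite !inE !ltn_ord => /(_ isT isT ij)/= h3.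
  by have := lt_trans h1 (lt_le_trans h2 h3); rewrite ltxx.
move=> i j _ _ [r [ri rj]]; apply/val_inj/eqP.
by case: ltngtP => // ij; [have := disj _ _ _ ij ri rj|have := disj _ _ _ ij rj ri].
Qed.

(** The step reaches [t] from some [s] on its left and then passes beyond [t], so
    that the supremum of the set of points where [P] holds satisfies [P] and
    cannot be smaller than [b]. *)
Lemma real_induction (a b : R) (P : R -> Prop) : a <= b -> P a ->
  (forall t, a <= t <= b -> exists2 r, 0 < r & forall s s',
    a <= s -> t - r < s -> s <= t -> t <= s' -> s' < t + r -> s' <= b ->
    P s -> P s') ->
  P b.
Proof.
move=> ab Pa step.
pose A := [set s | a <= s <= b /\ P s].
have Aa : A a by split => //; rewrite lexx.
have ubA : ubound A b by move=> s [/andP[]].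
have hsA : has_sup A by split; [exists a|exists b].
have acb : a <= sup A <= b.
  by apply/andP; split; [apply: (ub_le_sup hsA.2)|apply: ge_sup hsA.1 _].
have [r r0 hr] := step _ acb; have [aA Ab] := andP acb.
have [s [/andP[as_ sb] Ps] srs] := sup_adherent r0 hsA.
have sA : s <= sup A by apply: (ub_le_sup hsA.2); split; rewrite ?as_.
have [bA|bA] := ltP b (sup A + r).
  exact: (hr s b).
have Pr : P (sup A + r / 2).
  by apply: (hr s) => //; lra.
suff : sup A + r / 2 <= sup A by lra.
by apply: (ub_le_sup hsA.2); split => //; lra.
Qed.

(** Absolute continuity enters only through [x]: increments of [G] are bounded by
    those of [x] and of the identity, and only from above, so that [G] may contain
    the opposite of any nondecreasing function. Cover the exceptional null set by
    an open set [U] of small measure and run through [[a, b]] from the left. Near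
    a point outside [U] the slope condition controls the increase of [G]; the
    steps around points of [U] are collected in a family of disjoint intervals of
    small total length, over which [x], hence [G], increases little. *)
Lemma nonincreasing_of_slope (a b K L : R) x G :
  a <= b -> absolutely_continuous_on a b x -> 0 <= K -> 0 <= L ->
  (forall u v, a <= u -> u <= v -> v <= b ->
    G v - G u <= K * (v - u) + L * `|x v - x u|) ->
  {ae (@lebesgue_measure R), forall t, a < t < b -> slope_le G t 0} ->
  G b <= G a.
Proof.
move=> ab acx K0 L0 hG [A [mA A0 NA]].
suff main e : 0 < e -> G b - G a <= e * (b - a + K + L).
  rewrite -subr_le0; apply/ler_addgt0Pl => e e0; rewrite addr0.
  have c0 : 0 < b - a + K + L + 1 by lra.
  apply: (le_trans (main (e / (b - a + K + L + 1)) _)); first exact: divr_gt0.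
  by rewrite mulrAC ler_pdivrMr// ler_pM2l// lerDl.
move=> e0; have [d0 d00 hd0] := absolutely_continuous_on_seq acx e0.
pose d := Num.min d0 e; have dpos : 0 < d by rewrite lt_min d00 e0.
(* The end points are treated as exceptional: the slope there is unknown. *)
pose A' := A `|` [set a; b].
have mA' : measurable A' by apply: measurableU => //; exact: measurableU.
have A'0 : (mu A' = 0)%E.
  have mab : measurable [set a; b] by exact: measurableU.
  rewrite /A' measureU0//; apply: etrans (lebesgue_measure_set1 a).
  by apply: measureU0 => //; exact: lebesgue_measure_set1.
have A'oo : (mu A' < +oo)%E by rewrite A'0.
have [U [oU AU muU']] := lebesgue_regularity_outer mA' A'oo dpos.
have mU : measurable U by exact: open_measurable.
have muU : (mu U < d%:E)%E.
  have := measureU0 (mu := mu) (measurableD mU mA') mA' A'0.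
  by rewrite setUC setDUK// => ->.
pose len (l : seq (R * R)) := \sum_(p <- l) (p.2 - p.1).
pose var (l : seq (R * R)) := \sum_(p <- l) `|x p.2 - x p.1|.
pose P s := exists l, [/\ within_itv a s l, right_to_left l,
  ((len l)%:E <= mu (U `&` `]-oo, s[%classic))%E &
  G s - G a <= e * (s - a) + K * len l + L * var l].
suff : P b.
  move=> [l [lab rl lU /le_trans]]; apply.
  have {}lU : len l < d.
    rewrite -lte_fin (le_lt_trans lU)// (le_lt_trans _ muU)//.
    by rewrite le_measure ?inE//; exact: measurableI.
  have := lU; rewrite lt_min => /andP[ld le].
  have := hd0 _ lab rl ld; rewrite -/(var l) => ve.
  have := ler_wpM2l K0 (ltW le); have := ler_wpM2l L0 (ltW ve); lra.
apply: (@real_induction a b P) => //.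
  exists [::]; split => //; rewrite /len /var ?big_nil//.
  by rewrite !subrr !mulr0 !addr0.
have widen s s' l : s <= s' -> within_itv a s l -> within_itv a s' l.
  by move=> ss' /allP h; apply/allP => p /h /andP[-> /= /le_trans ->].
move=> t /andP[at_ tb]; have [Ut|NUt] := pselect (U t).
  have /nbhs_ballP[r /= r0 hr] : nbhs t U by exact: open_nbhs_nbhs.
  exists r => // s s' as_ rs st ts' s'r s'b [l [las rl lU Gs]].
  have ss' := le_trans st ts'.
  exists ((s, s') :: l); split.
  - by rewrite /within_itv/= as_ ss' lexx/=; exact: widen las.
  - rewrite /right_to_left/=; apply/andP; split => //.
    by apply/allP => p /(allP las) /andP[].
  - rewrite /len big_cons/= -/(len l) addrC EFinD.
    rewrite (_ : (s' - s)%:E = mu `[s, s'[%classic); last first.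
      rewrite lebesgue_measure_itv/= lte_fin.
      by case: ltgtP ss' => // -> _; rewrite subrr.
    apply: (le_trans (leeD lU (lexx _))).
    rewrite -measureU//=.
    + rewrite le_measure ?inE//.
      * by apply: measurableU => //; exact: measurableI.
      * exact: measurableI.
      * move=> y [[Uy]|]; rewrite /= ?in_itv/= => ys.
          by split; rewrite // ?in_itv/= (lt_le_trans ys).
        have /andP[sy ys'] := ys.
        split; last exact: ys'.
        apply: hr; rewrite /ball/= ltr_norml.
        by apply/andP; split; lra.
    + exact: measurableI.
    + apply/seteqP; split => // y [[_]]; rewrite /= !in_itv/= => ys /andP[].
      by rewrite leNgt ys.
  - rewrite /len /var !big_cons/= -/(len l) -/(var l).
    have := hG s s' as_ ss' s'b.
    have es : 0 <= e * (s' - s) by rewrite mulr_ge0 ?subr_ge0// ltW.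
    lra.
have atb : a < t < b.
  rewrite !lt_neqAle at_ tb !andbT; apply/andP; split; apply/eqP => abt;
    apply: NUt; apply: AU; right; [left|right]; by rewrite ?abt -?abt.
have slt : slope_le G t 0.
  apply: contrapT => nslt; apply: NUt; apply: AU; left; apply: NA => /=.
  by move/(_ atb).
have [r /= r0 hr] := (nbhs_ballP _ _).1 (slt e e0).
exists r => // s s' as_ rs st ts' s'r s'b [l [las rl lU Gs]].
have ss' := le_trans st ts'.
have hGt y : t - r < y -> y < t + r -> (y - t) * (G y - G t) <= e * (y - t) ^+ 2.
  move=> h1 h2; have := hr y; rewrite add0r /ball/= ltr_norml; apply.
  by apply/andP; split; lra.
exists l; split => //.
- exact: widen las.
- apply: (le_trans lU); rewrite le_measure ?inE//; try exact: measurableI.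
  move=> y [Uy]; rewrite /= !in_itv/= => ys; split => //.
  by rewrite (lt_le_trans ys).
- have G1 : G t - G s <= e * (t - s).
    have [->|st'] := eqVneq s t; first by rewrite !subrr mulr0.
    have st0 : 0 < t - s by rewrite subr_gt0 lt_neqAle st' st.
    have st2 : s < t + r by lra.
    rewrite -(ler_pM2l st0); have := hGt s rs st2; nra.
  have G2 : G s' - G t <= e * (s' - t).
    have [->|st'] := eqVneq s' t; first by rewrite !subrr mulr0.
    have st0 : 0 < s' - t by rewrite subr_gt0 lt_neqAle eq_sym st' ts'.
    have st2 : t - r < s' by lra.
    rewrite -(ler_pM2l st0); have := hGt s' st2 s'r; nra.
  lra.
Qed.

End Growth.

(** * Distance to a set *)

Section Distance.
Set Implicit Arguments.
Unset Strict Implicit.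
Local Open Scope ring_scope.
Context {R : realType} {H : completeNormedModType R}.
Implicit Types (y p : H) (S : set H).

Lemma bounded_set_norm S : bounded_set S ->
  exists M : R, forall z, S z -> `|z| <= M.
Proof.
by move=> [M [_ hM]]; exists (M + 1) => z; apply: (hM (M + 1)); rewrite ?ltrDl.
Qed.

Let has_lbound_dist y S : has_lbound [set `|y - z| | z in S].
Proof. by exists 0 => _ [z _ <-]; exact: normr_ge0. Qed.

Lemma dist_set_le y S p : S p -> dist_set y S <= `|y - p|.
Proof. by move=> Sp; apply: ge_inf => //; exists p. Qed.

Lemma dist_set_ge0 y S : S !=set0 -> 0 <= dist_set y S.
Proof.
move=> [p Sp]; apply: lb_le_inf; first by exists `|y - p|, p.
by move=> _ [z _ <-].
Qed.

Lemma dist_set_adherent y S (e : R) : S !=set0 -> 0 < e ->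
  exists2 p, S p & `|y - p| < dist_set y S + e.
Proof.
move=> [p Sp] e0.
have hS : has_inf [set `|y - z| | z in S].
  by split => //; exists `|y - p|, p.
by have [_ [z Sz <-] hz] := inf_adherent e0 hS; exists z.
Qed.

Lemma dist_set_lipschitz y y' S : S !=set0 ->
  dist_set y S <= dist_set y' S + `|y - y'|.
Proof.
move=> S0; apply/ler_addgt0Pl => e e0.
have [p Sp hp] := dist_set_adherent y' S0 e0.
apply: (le_trans (dist_set_le y Sp)).
have := ler_normD (y - y') (y' - p); rewrite addrA subrK; lra.
Qed.

Lemma dist_set_sqr_adherent y S (e : R) : S !=set0 -> 0 < e ->
  exists2 p, S p & `|y - p| ^+ 2 <= dist_set y S ^+ 2 + e.
Proof.
move=> S0 e0; have D0 := dist_set_ge0 y S0.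
set D := dist_set y S in D0 *.
have c0 : 0 < 2 * D + 1 by lra.
have h0 : 0 < Num.min 1 (e / (2 * D + 1)) by rewrite lt_min ltr01 divr_gt0.
have [p Sp hp] := dist_set_adherent y S0 h0; exists p => //.
set h := Num.min _ _ in h0 hp.
have h1 : h <= 1 by rewrite ge_min lexx.
have he : h * (2 * D + 1) <= e by rewrite -ler_pdivlMr// ge_min lexx orbT.
have hD : `|y - p| <= D + h by exact: ltW.
apply: (@le_trans _ _ ((D + h) ^+ 2)); first by rewrite ler_sqr ?nnegrE//; lra.
nra.
Qed.

Lemma dist_set1 y p : dist_set y [set p] = `|y - p|.
Proof. by rewrite /dist_set image_set1 inf1. Qed.

(** A gap [d] between the values of a convex function at distance [e] from [S] and
    on [S] persists further away. If [y] is far from [S], a point [y'] of the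
    segment from an almost nearest [z] in [S] to [y] is still at distance at least
    [e] from [S], but lies in the ball where the gap is known; by convexity the
    function has grown at least as much when it reaches [y]. *)
Lemma econvex_separation (g : H -> \bar R) S (M v d e : R) :
  econvex g -> S !=set0 -> (forall z, S z -> `|z| <= M) -> 0 < e -> 0 <= d ->
  (forall z, S z -> (-oo < g z <= v%:E)%E) ->
  (forall y, `|y| <= M + 2 * e -> e <= dist_set y S -> ((v + d)%:E <= g y)%E) ->
  forall y, e <= dist_set y S -> ((v + d)%:E <= g y)%E.
Proof.
move=> cg S0 SM e0 d0 gS gb y ey.
have e20 : 0 < e / 2 by rewrite divr_gt0.
have [z Sz yz] := dist_set_adherent y S0 e20.
have zM := SM _ Sz.
have [yz2|yz2] := leP `|y - z| (2 * e).
  apply: gb => //; have := ler_normD (y - z) z; rewrite subrK; lra.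
set D := dist_set y S in ey yz *; set n := `|y - z| in yz yz2.
have n0 : 0 < n by lra.
have Dn : D <= n by exact: dist_set_le.
(* With this [l] the point [y'] below is at distance [D - e] from [y]. *)
pose l := 1 - (D - e) / n.
have ln : (1 - l) * n = D - e by rewrite /l; field; lra.
have l1 : 0 < l < 1 by apply/andP; split; nra.
have [l0 l1'] := andP l1.
pose y' := l *: y + (1 - l) *: z.
have yy' : `|y - y'| = D - e.
  have -> : y - y' = (1 - l) *: (y - z).
    by rewrite /y' scalerBr opprD addrA [(1 - l) *: y]scalerBl scale1r.
  by rewrite normrZ gtr0_norm ?subr_gt0.
have y'z : `|y' - z| <= 2 * e.
  have -> : y' - z = l *: (y - z).
    rewrite /y' -addrA scalerBr; congr (_ + _).
    by rewrite scalerBl scale1r addrAC subrr sub0r.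
  by rewrite normrZ gtr0_norm// -/n; lra.
have : ((v + d)%:E <= g y')%E.
  apply: gb; first by have := ler_normD (y' - z) z; rewrite subrK; lra.
  by have := dist_set_lipschitz y y' S0; rewrite yy' -/D; lra.
move=> /le_trans/(_ (cg y z l l1)).
have /andP[] := gS _ Sz; case: (g z) => [q _| |] //.
rewrite lee_fin => qv; case: (g y) => [r| |].
- rewrite -!EFinM -EFinD !lee_fin => h; rewrite leNgt; apply/negP => rv.
  have h1 : (1 - l) * q <= (1 - l) * v by rewrite ler_pM2l// subr_gt0.
  have h2 : l * r < l * (v + d) by rewrite ltr_pM2l.
  have h3 : l * d <= 1 * d by rewrite ler_wpM2r// ltW.
  lra.
- by rewrite leey.
- by rewrite gt0_muleNy ?lte_fin.
Qed.

End Distance.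

Section SlopeOfDistance.
Set Implicit Arguments.
Unset Strict Implicit.
Local Open Scope ring_scope.
Context {R : realType} {H : completeNormedModType R}.
Variable ip : {dot H for (@idfun R)}.
Hypothesis hH : induces_norm ip.
Implicit Types (x : R -> H) (S : set H).

Lemma derivable_near x (t e : R) : derivable x t 1 -> 0 < e ->
  \forall s \near t, `|x s - x t - (s - t) *: derive1 x t| <= e * `|s - t|.
Proof.
move=> dx e0.
have := (cvgrPdist_le _ _).1 dx e e0.
rewrite -/('D_1 x t) -derive1E => near0.
have [r /= r0 hr] := (nbhs_ballP _ _).1 (near0 _).
apply/nbhs_ballP; exists r => // s /= ts.
have [->|st] := eqVneq s t; first by rewrite !subrr scale0r subr0 !normr0 mulr0.
have st0 : s - t != 0 by rewrite subr_eq0.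
have h0 : ball 0 r (s - t) by move: ts; rewrite /ball/= sub0r normrN distrC.
have := hr _ h0 st0; rewrite /= [(_ - _)%R *: 1](mulr1 _) subrK.
rewrite -(ler_pM2r (_ : 0 < `|s - t|)) ?normr_gt0// mulrC -normrZ.
by rewrite scalerBr scalerA divff// scale1r distrC.
Qed.

(** This replaces differentiation of the squared distance. To bound its increment
    between [t] and [s] from above, compare both points with an almost nearest
    point [p] of [S] to the one at the earlier time; the increment of
    [`|x - p| ^+ 2] is twice [ip (x s - x t) (x t - p)] up to second order. As the
    hypothesis concerns every [p] in [S], the bound is uniform although [p] varies
    with [s]. *)
Lemma slope_dist_set x S (t k M : R) : S !=set0 ->
  (forall p, S p -> `|p| <= M) -> derivable x t 1 ->
  (forall p, S p -> ip (derive1 x t) (x t - p) <= k) ->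
  slope_le (fun s => dist_set (x s) S ^+ 2) t (2 * k).
Proof.
move=> S0 SM dx hk e e0; have [p0 Sp0] := S0.
have M0 : 0 <= M by exact: le_trans (normr_ge0 _) (SM _ Sp0).
set x' := derive1 x t in hk.
pose C := `|x t| + M + 1.
have C0 : 0 < C by rewrite /C; have := normr_ge0 (x t); lra.
pose V := `|x'| + 1.
have V0 : 0 < V by rewrite /V; have := normr_ge0 x'; lra.
have e10 : 0 < Num.min 1 (e / (4 * C)).
  by rewrite lt_min ltr01 divr_gt0// mulr_gt0.
set e1 := Num.min _ _ in e10.
have e11 : e1 <= 1 by rewrite ge_min lexx.
have e1C : e1 * C <= e / 4.
  rewrite -ler_pdivlMr// ge_min; apply/orP; right.
  by rewrite invfM mulrA.
pose r := e / (2 * (V ^+ 2 + 1)).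
have V20 : 0 < V ^+ 2 + 1 by have := sqr_ge0 V; lra.
have r0 : 0 < r by rewrite divr_gt0// mulr_gt0.
have rV : r * (V ^+ 2 + 1) = e / 2 by rewrite /r; field; lra.
near=> s.
have hs : `|x s - x t - (s - t) *: x'| <= e1 * `|s - t|.
  by near: s; exact: derivable_near.
have sr : `|s - t| <= r.
  rewrite distrC; near: s; apply/nbhs_ballP; exists r => //= y.
  exact: ltW.
have [->|st] := eqVneq s t; first by rewrite subrr mul0r expr0n mulr0.
set w := s - t in hs sr *; set D := x s - x t in hs.
have w0 : 0 < `|w| by rewrite normr_gt0 subr_eq0.
have w20 : 0 < w ^+ 2 by rewrite -real_normK ?num_real// exprn_gt0.
have [p Sp hp] : exists2 p, S p &
    w * (dist_set (x s) S ^+ 2 - dist_set (x t) S ^+ 2) <=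
    w * (2 * ip D (x t - p) + `|D| ^+ 2) + `|w| * w ^+ 2.
  have dist_sqr y p : S p -> dist_set y S ^+ 2 <= `|y - p| ^+ 2.
    by move=> Sp; rewrite ler_sqr ?nnegrE// ?dist_set_ge0// dist_set_le.
  have Dp p : 2 * ip D (x t - p) + `|D| ^+ 2 = `|x s - p| ^+ 2 - `|x t - p| ^+ 2.
    have -> : x s - p = D + (x t - p) by rewrite /D addrA subrK.
    by rewrite (normD_sqr hH); ring.
  have [ws|ws] := ltP 0 w.
    have [p Sp hp] := dist_set_sqr_adherent (x t) S0 w20; exists p => //.
    rewrite Dp gtr0_norm// -mulrDr ler_pM2l//; have := dist_sqr (x s) _ Sp; lra.
  have [p Sp hp] := dist_set_sqr_adherent (x s) S0 w20; exists p => //.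
  have nw : 0 < - w by rewrite -(ler0_norm ws).
  rewrite Dp (ler0_norm ws).
  have := dist_sqr (x t) _ Sp; rewrite -(ler_pM2l nw) => h1.
  have := ler_wpM2l (ltW nw) hp; lra.
apply: (le_trans hp).
have Dw : `|D| <= V * `|w|.
  have := ler_normD (D - w *: x') (w *: x'); rewrite subrK normrZ.
  have := ler_wpM2r (ltW w0) e11; rewrite /V; lra.
have pC : `|x t - p| <= C.
  have := ler_normB (x t) p; have := SM _ Sp; rewrite /C; lra.
have ww : w * w = `|w| * `|w| by rewrite -!expr2 real_normK ?num_real.
have h1 : w * ip D (x t - p) <= w ^+ 2 * k + e1 * C * w ^+ 2.
  rewrite -[D](subrK (w *: x')) ipDl ipZl mulrDr addrC lerD//.
    by rewrite mulrA -expr2 ler_wpM2l ?hk// ltW.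
  apply: (le_trans (ler_norm _)); rewrite normrM.
  have := cauchy_schwarz_norm hH (D - w *: x') (x t - p).
  have := ler_pM (normr_ge0 _) (normr_ge0 _) hs pC.
  move=> /[swap] /le_trans/[apply]; rewrite -(ler_pM2l w0) => /le_trans; apply.
  by rewrite expr2 ww le_eqVlt; apply/orP; left; apply/eqP; ring.
have h2 : w * `|D| ^+ 2 <= V ^+ 2 * `|w| * w ^+ 2.
  apply: (le_trans (ler_norm _)); rewrite normrM [`| `|D| ^+ 2|]ger0_norm ?sqr_ge0//.
  have : `|D| ^+ 2 <= (V * `|w|) ^+ 2 by rewrite ler_sqr ?nnegrE// mulr_ge0// ltW.
  rewrite -(ler_pM2l w0) => /le_trans; apply.
  by rewrite [w ^+ 2]expr2 ww le_eqVlt; apply/orP; left; apply/eqP; ring.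
have h3 : `|w| * (V ^+ 2 + 1) <= e / 2 by rewrite -rV ler_pM2r.
have h4 := ler_wpM2r (ltW w20) e1C.
have h5 := ler_wpM2r (ltW w20) h3.
lra.
Unshelve. all: by end_near. Qed.

End SlopeOfDistance.

Section SlopeOfDifference.
Set Implicit Arguments.
Unset Strict Implicit.
Local Open Scope ring_scope.
Context {R : realType}.

Lemma slope_leB (F W : R -> R) (t a c : R) : slope_le F t a ->
  derivable W t 1 -> slope_le (fun s => F s - c * W s) t (a - c * derive1 W t).
Proof.
move=> Ft dW e e0.
have e20 : 0 < e / 2 by rewrite divr_gt0.
have c0 : 0 < `|c| + 1 by rewrite ltr_pwDr.
have ec0 : 0 < e / 2 / (`|c| + 1) by rewrite divr_gt0.
near=> s.
have h1 : (s - t) * (F s - F t) <= (a + e / 2) * (s - t) ^+ 2 by near: s; exact: Ft.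
(* The divisor absorbs the factor [c], which may vanish. *)
have h2 : `|W s - W t - (s - t) * derive1 W t| <= e / 2 / (`|c| + 1) * `|s - t|.
  by near: s; exact: (@derivable_near R R W).
have h3 : - (c * ((s - t) * (W s - W t - (s - t) * derive1 W t))) <=
    e / 2 * (s - t) ^+ 2.
  apply: (le_trans (ler_norm _)); rewrite normrN !normrM.
  rewrite -(real_normK (num_real (s - t))) expr2.
  rewrite mulrCA [leRHS]mulrCA ler_wpM2l//.
  apply: (le_trans (ler_wpM2l (normr_ge0 c) h2)).
  rewrite mulrA ler_wpM2r// mulrA ler_pdivrMr//.
  by rewrite mulrC ler_pM2l// lerDl.
lra.
Unshelve. all: by end_near. Qed.

End SlopeOfDifference.

(** * Proximal points *)

Section Proximal.
Set Implicit Arguments.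
Unset Strict Implicit.
Local Open Scope ring_scope.
Context {R : realType} {H : completeNormedModType R}.
Variable ip : {dot H for (@idfun R)}.
Hypothesis hH : induces_norm ip.

(** The point [y] minimizes [f + 2^-1 * `|. - z| ^+ 2]. A subgradient [p] of [f]
    bounds this function from below, and its minimizing sequences are Cauchy by
    the parallelogram identity. *)
Lemma proximal_point (f : H -> \bar R) (x0 p z : H) :
  closed_convex f -> subdifferential ip f x0 p ->
  exists y, subdifferential ip f y (z - y).
Proof.
move=> [fNy lscf cf] [fx0 hp].
have fin y : (f y < +oo)%E -> (fine (f y))%:E = f y.
  by move=> fy; rewrite fineK// fin_numE fNy lt_eqF.
pose q y : R := 2^-1 * `|y - z| ^+ 2.
pose V := [set fine (f y) + q y | y in [set y | (f y < +oo)%E]].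
have infV : has_inf V.
  split; first by exists (fine (f x0) + q x0), x0.
  (* Complete the square in the affine minorant plus the quadratic term. *)
  exists (fine (f x0) + ip p (z - x0) - 2^-1 * `|p| ^+ 2) => _ [y fy <-].
  have := hp y; rewrite -(fin _ fx0) -(fin _ fy) -EFinD lee_fin.
  have := sqr_ge0 `|(y - z) + p|; rewrite (normD_sqr hH) /q !ipDr !ipNr ipDl ipNl.
  rewrite (ipC ip y) (ipC ip z); lra.
pose m := inf V.
have mle y : (f y < +oo)%E -> m <= fine (f y) + q y.
  by move=> fy; apply: ge_inf; [exact: infV.2|exists y].
have /choice[u hu] n : exists y, (f y < +oo)%E /\ fine (f y) + q y < m + n.+1%:R^-1.
  have n0 : 0 < n.+1%:R^-1 :> R by rewrite invr_gt0.
  by have [_ [y fy <-] hy] := inf_adherent n0 infV; exists y.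
have half01 : 0 < (2^-1 : R) < 1 by lra.
have hdist i j : `|u i - u j| ^+ 2 <= 4 * (i.+1%:R^-1 + j.+1%:R^-1).
  have [fi hi] := hu i; have [fj hj] := hu j.
  have := cf (u i) (u j) _ half01.
  have -> : 1 - 2^-1 = 2^-1 :> R by field.
  set w := (_ *: _ + _)%R.
  rewrite -(fin _ fi) -(fin _ fj) -!EFinM -EFinD => fw.
  have fw' := le_lt_trans fw (ltry _).
  move: fw; rewrite -(fin _ fw') lee_fin => fw.
  have := mle _ fw'.
  have qw : q w = 2^-1 * q (u i) + 2^-1 * q (u j) - 8^-1 * `|u i - u j| ^+ 2.
    have -> : u i - u j = (u i - z) - (u j - z) by rewrite opprB addrA subrK.
    rewrite /q; have -> : w - z = 2^-1 *: (u i - z) + 2^-1 *: (u j - z).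
      rewrite /w !scalerBr addrACA -opprD -scalerDl.
      have -> : 2^-1 + 2^-1 = 1 :> R by field.
      by rewrite scale1r.
    rewrite (sqr_normB hH (u i - z)) (normD_sqr hH (2^-1 *: _)) !normrZ ipZl ipZr.
    rewrite !exprMn.
    by rewrite real_normK ?num_real//; field.
  rewrite qw; clear -hi hj fw; move: hi hj fw.
  by move: (i.+1%:R^-1) (j.+1%:R^-1) (q (u i)) (q (u j)) => a b c d; lra.
have cu : cvg (u @ \oo).
  apply: cauchy_cvg; apply: cauchy_exP => e e0.
  have e20 : 0 < e ^+ 2 / 8 by rewrite divr_gt0// exprn_gt0.
  have [N _ hN] : \forall n \near \oo, n.+1%:R^-1 < e ^+ 2 / 8 :> R.
    exact: (cvgr_lt 0 (@cvg_harmonic R)).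
  exists (u N); exists N => // n Nn; rewrite -ball_normE/=.
  rewrite -ltr_sqr ?nnegrE ?normr_ge0//; last exact: ltW.
  apply: (le_lt_trans (hdist N n)).
  have : N.+1%:R^-1 < e ^+ 2 / 8 := hN _ (leqnn N).
  have : n.+1%:R^-1 < e ^+ 2 / 8 := hN _ Nn.
  by move: (N.+1%:R^-1) (n.+1%:R^-1) => a b; lra.
pose y := lim (u @ \oo); exists y.
have cq : m + n.+1%:R^-1 - q (u n) @[n --> \oo] --> m + 0 - q y.
  apply: cvgB; first by apply: cvgD; [exact: cvg_cst|exact: cvg_harmonic].
  apply: cvgMr; rewrite expr2; under eq_fun do rewrite expr2.
  by apply: cvgM; apply: cvg_norm; apply: cvgB => //; exact: cvg_cst.
have fym : (f y <= (m - q y)%:E)%E.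
  rewrite leNgt; apply/negP => yf.
  have [a Aa afy] : exists2 a, m - q y < a & (a%:E < f y)%E.
    case: (f y) yf => [r| |]//; last by exists (m - q y + 1); rewrite ?ltry//; lra.
    by rewrite lte_fin => yr; exists ((m - q y + r) / 2); rewrite ?lte_fin; lra.
  have [W yW Wf] := lscf _ _ afy.
  have h1 : \forall n \near \oo, W (u n) by exact: cu.
  have h2 : \forall n \near \oo, m + n.+1%:R^-1 - q (u n) < a.
    by apply: (cvgr_lt _ cq); rewrite addr0.
  have [N _ hN] := filterI h1 h2; have [/Wf + h3] := hN N (leqnn N).
  have [fN hfN] := hu N; rewrite -(fin _ fN) lte_fin.
  by move: hfN h3; move: (N.+1%:R^-1) => b /=; lra.
have fy := le_lt_trans fym (ltry _).
split => // w; rewrite -(fin _ fy).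
case: (ltP (f w) +oo%E) => [fw|]; last by rewrite leye_eq => /eqP ->; rewrite leey.
rewrite -(fin _ fw) -EFinD lee_fin.
move: fym; rewrite -(fin _ fy) lee_fin => fym.
(* Compare [y] with a point [c] of the segment to [w] so close to [y] that the
   quadratic term costs at most [e]. *)
apply/ler_addgt0Pr => e e0.
pose n2 := `|w - y| ^+ 2; have n20 : 0 <= n2 by exact: sqr_ge0.
pose s := Num.min 2^-1 (e / (n2 + 1)).
have s0 : 0 < s by rewrite lt_min invr_gt0 ltr0n/= divr_gt0//; lra.
have s1 : s < 1 by rewrite gt_min; apply/orP; left; lra.
have sn : s * n2 <= e.
  apply: (@le_trans _ _ (s * (n2 + 1))); first by rewrite ler_pM2l// lerDl.
  by rewrite -ler_pdivlMr ?ge_min ?lexx ?orbT//; lra.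
have s01 : 0 < s < 1 by rewrite s0 s1.
have := cf w y _ s01; set c := (_ *: _ + _)%R.
rewrite -(fin _ fw) -(fin _ fy) -!EFinM -EFinD => fc.
have fc' := le_lt_trans fc (ltry _).
have := mle _ fc'; move: fc; rewrite -(fin _ fc') lee_fin.
have cz : c - z = (y - z) + s *: (w - y).
  by rewrite /c scalerBl scale1r scalerBr addrCA addrAC (addrC _ (- z)) !addrA.
rewrite /q cz (normD_sqr hH) normrZ exprMn real_normK ?num_real// -/n2 ipZr.
move=> h1 h2.
rewrite /q in fym.
have ipyz : ip (z - y) (w - y) = - ip (y - z) (w - y) by rewrite -ipNl opprB.
rewrite ipyz -(ler_pM2l s0).
have h3 : s * (s * n2) <= s * e by rewrite ler_pM2l.
have h4 : 0 <= s * e by rewrite mulr_ge0 ?ltW.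
nra.
Qed.

(** The proximal point [y] of [z] gives the pair [(y, z - y)] of the graph, at which
    the expression under the supremum is a square. *)
Lemma brezis_haraux_subdifferential_ge0 (f : H -> \bar R) (x0 p z : H) :
  closed_convex f -> subdifferential ip f x0 p ->
  (0 <= brezis_haraux ip (subdifferential ip f) z 0%R)%E.
Proof.
move=> cf sp; have [y yz] := proximal_point z cf sp.
apply: (@le_trans _ _ (`|z - y| ^+ 2)%:E); first by rewrite lee_fin sqr_ge0.
apply: ereal_sup_ubound; exists (y, z - y) => //=.
by rewrite subr0 (ip_norm hH).
Qed.

End Proximal.

(** * Uniform gap away from the limit minimizers *)

Section Gap.
Set Implicit Arguments.
Unset Strict Implicit.
Local Open Scope ring_scope.
Context {R : realType} {H : completeNormedModType R}.
Variables (phi : R -> H -> \bar R) (phi_inf : H -> \bar R).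
Hypothesis hphi : forall t : R, 0 <= t -> closed_convex (phi t).
Hypothesis hphi_inf : closed_convex phi_inf /\ eproper phi_inf.
Hypothesis S0 : argmin phi_inf !=set0.
Hypothesis H2 : forall (t : nat -> R) (xs : nat -> H) (x_inf : H),
  (forall k, 0 <= t k) -> t k @[k --> \oo] --> +oo%R ->
  xs k @[k --> \oo] --> x_inf ->
  (phi_inf x_inf <= limn_einf (fun k => phi (t k) (xs k)))%E.
Hypothesis H3 : ereal_sup [set phi t z | z in argmin phi_inf] @[t --> +oo%R]
  --> ereal_inf (range phi_inf).
Hypothesis H4 : exists (t0 : R) (f : H -> \bar R),
  [/\ 0 <= t0,
      forall r l : R, 0 < r ->
        precompact [set x : H | `|x| <= r /\ (f x <= l%:E)%E]
    & forall t : R, t0 <= t -> forall x : H, (f x <= phi t x)%E].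

Local Notation S := (argmin phi_inf).
Local Notation vsup t := (ereal_sup [set phi t z | z in argmin phi_inf]).

Lemma limn_einf_le_cvg (u w : nat -> \bar R) l :
  (forall n, (u n <= w n)%E) -> w n @[n --> \oo] --> l ->
  (limn_einf u <= l)%E.
Proof.
move=> uw wl; rewrite limn_einf_lim -(cvg_lim _ wl)//.
apply: lee_lim; [exact: is_cvg_einfs|by apply/cvg_ex; exists l|].
apply: nearW => n; apply: le_trans (uw n).
by apply: ereal_inf_lbound; exists n => //=.
Qed.

Lemma min_fin : exists m : R, ereal_inf (range phi_inf) = m%:E.
Proof.
have [[[hNy _ _] [y hy]] [z Sz]] := (hphi_inf, S0).
have := Sz y; have := hNy z; case zm : (phi_inf z) => [m| |] // _ h.
  exists m; apply/eqP; rewrite eq_le; apply/andP; split.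
    by rewrite -zm; apply: ereal_inf_lbound; exists z.
  by apply: le_ereal_inf_tmp => _ [w _ <-]; rewrite -zm; exact: Sz.
by have := le_lt_trans h hy; rewrite ltxx.
Qed.

Lemma cvg_vsup_fin (m : R) : ereal_inf (range phi_inf) = m%:E ->
  forall e, 0 < e -> \forall t \near +oo%R,
    vsup t \is a fin_num /\ `|m - fine (vsup t)| <= e.
Proof.
move=> hm e e0; move: H3; rewrite hm => /fine_cvgP[h1 h2].
near=> t; split; near: t => //.
exact: (cvgrPdist_le _ _).1 h2 e e0.
Unshelve. all: by end_near. Qed.

(** The common minorant of the functions puts the points [y k] into a relatively
    compact set. A cluster point is a limit of [y (k j)] for some indices
    [k j >= j], and the lower limit inequality bounds [phi_inf] there by the limit
    of the suprema over [S], which is the minimum of [phi_inf]. *)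
Lemma argmin_cluster (t : nat -> R) (y : nat -> H) (M : R) :
  (forall k, k%:R <= t k) -> (forall k, `|y k| <= M) ->
  (forall k, (phi (t k) (y k) <= vsup (t k) + (k.+1%:R^-1)%:E)%E) ->
  exists2 p, S p & forall (e : R) N, 0 < e -> exists2 k, (N <= k)%N & `|y k - p| < e.
Proof.
move=> tk yM phiy; have [m hm] := min_fin.
have [t0 [f [t00 cf fphi]]] := H4.
have cvgt (k : nat -> nat) : (forall j, (j <= k j)%N) ->
    t (k j) @[j --> \oo] --> +oo%R.
  move=> kj; apply/cvgryPge => A; near=> j.
  apply: (le_trans _ (tk _)); apply: (@le_trans _ _ j%:R); last by rewrite ler_nat.
  by near: j; exact: nbhs_infty_ger.
have [N0 _ hN0] : \forall k \near \oo, t0 <= t k /\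
    (vsup (t k) \is a fin_num /\ `|m - fine (vsup (t k))| <= 1).
  have ct := cvgt id (fun=> leqnn _).
  apply: filterI; first by move/cvgryPge : ct; exact.
  exact: ct (cvg_vsup_fin hm ltr01).
have M1 : 0 < M + 1 by have := le_trans (normr_ge0 _) (yM 0%N); lra.
have := cf _ (m + 2) M1; rewrite precompactE.
move=> /(_ (y @ \oo) _)[].
  exists N0 => // k N0k; apply: subset_closure; split; first by have := yM k; lra.
  have [h1 [h2 h3]] := hN0 _ N0k.
  apply: (le_trans (fphi _ h1 _)); apply: (le_trans (phiy k)).
  rewrite -(fineK h2) -EFinD lee_fin.
  have : k.+1%:R^-1 <= 1 :> R by rewrite invf_le1// ler1n.
  by move: h3; rewrite ler_norml; move: (_^-1) => b; lra.
move=> p [_ pcl].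
have hp e N : 0 < e -> exists2 k, (N <= k)%N & `|y k - p| < e.
  move=> e0.
  have /= [|_ [[k Nk <-] pk]] :=
    pcl [set y k | k in [set k | (N <= k)%N]] (ball p e) _ (nbhsx_ballx _ _ e0).
    by exists N => // k Nk; exists k.
  by exists k => //; rewrite distrC; move: pk; rewrite -ball_normE.
exists p => //.
have /choice[k hk] (j : nat) : exists k, (j <= k)%N /\ `|y k - p| < j.+1%:R^-1.
  by have [|k] := hp j.+1%:R^-1 j; [rewrite invr_gt0|exists k].
have kj j : (j <= k j)%N by have [] := hk j.
have yp : y (k j) @[j --> \oo] --> p.
  apply/cvgrPdist_lt => e e0.
  have [N _ hN] : \forall n \near \oo, n.+1%:R^-1 < e :> R.
    exact: (cvgr_lt 0 (@cvg_harmonic R)).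
  exists N => // j Nj; rewrite distrC; apply: lt_trans (hN _ Nj).
  by have [] := hk j.
have tpos j : 0 <= t (k j) by exact: le_trans (tk _).
have := H2 tpos (cvgt _ kj) yp => /le_trans h z; apply: h.
apply: (@le_trans _ _ m%:E); last first.
  by rewrite -hm; apply: ereal_inf_lbound; exists z.
apply: (@limn_einf_le_cvg _ (fun j => vsup (t (k j)) + (j.+1%:R^-1)%:E)%E).
  move=> j; apply: (le_trans (phiy (k j))); apply: leeD => //.
  by rewrite lee_fin lef_pV2 ?posrE// ler_nat ltnS.
rewrite -[m%:E]adde0; apply: cvgeD => //.
  by rewrite -hm; apply: cvg_comp H3; exact: cvgt.
exact: cvge_harmonic.
Unshelve. all: by end_near. Qed.

(** In a ball, the absence of a gap would yield almost minimizing points at distance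
    at least [e] from [S], whose cluster point would be in [S]. Convexity extends
    the gap to the whole space. *)
Lemma uniform_gap (e : R) : bounded_set S -> 0 < e ->
  exists d T : R, [/\ 0 < d, 0 <= T & forall t, T <= t ->
    vsup t \is a fin_num /\
    forall y, e <= dist_set y S -> (vsup t + d%:E <= phi t y)%E].
Proof.
move=> bS e0; have [M SM] := bounded_set_norm bS.
have [k hk] : exists k : nat, forall t y, k%:R <= t -> `|y| <= M + 2 * e ->
    e <= dist_set y S -> (vsup t + (k.+1%:R^-1)%:E <= phi t y)%E.
  apply: contrapT => nk.
  have /choice[ty hty] (k : nat) : exists ty : R * H, [/\ k%:R <= ty.1,
      `|ty.2| <= M + 2 * e, e <= dist_set ty.2 S &
      (phi ty.1 ty.2 <= vsup ty.1 + (k.+1%:R^-1)%:E)%E].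
    apply: contrapT => nty; apply: nk; exists k => t y kt yM ey.
    rewrite leNgt; apply/negP => h; apply: nty; exists (t, y); split => //.
    exact: ltW.
  have [p Sp hp] := @argmin_cluster (fun k => (ty k).1) (fun k => (ty k).2) (M + 2 * e)
    (fun k => let: And4 h _ _ _ := hty k in h)
    (fun k => let: And4 _ h _ _ := hty k in h)
    (fun k => let: And4 _ _ _ h := hty k in h).
  have [k _ hk] := hp e 0%N e0; have [_ _ h _] := hty k.
  by have := le_lt_trans (le_trans h (dist_set_le _ Sp)) hk; rewrite ltxx.
have [m hm] := min_fin.
have [T [Tr hT]] := cvg_vsup_fin hm ltr01.
exists k.+1%:R^-1, (Num.max k%:R (T + 1)); split.
- by rewrite invr_gt0.
- by rewrite le_max ler0n.
- move=> t; rewrite ge_max => /andP[kt Tt].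
  have {}Tt : T < t by lra.
  have [vfin _] := hT _ Tt; split => //.
  have t0 : 0 <= t by exact: le_trans kt.
  have [hNy _ ct] := hphi t0.
  rewrite -(fineK vfin) -EFinD => y ey.
  apply: (econvex_separation ct S0 SM e0) ey => //.
  + move=> z Sz; rewrite ltNye hNy/= fineK//.
    by apply: ereal_sup_ubound; exists z.
  + by move=> y' yM ey'; rewrite EFinD fineK//; exact: hk.
Qed.

(** Points of [S] almost nearest to the trajectory satisfy the hypotheses of
    [argmin_cluster]; hence a trajectory that approaches [S] accumulates, in norm,
    at a point of [S]. *)
Lemma trajectory_cluster (x : R -> H) : bounded_set S ->
  dist_set (x t) S @[t --> +oo%R] --> (0 : R) ->
  exists2 p, S p & forall (e : R) N, 0 < e ->
    exists2 k, (N <= k)%N & `|x k%:R - p| < e.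
Proof.
move=> bS dist0; have [M SM] := bounded_set_norm bS.
have n0 (k : nat) : 0 < k.+1%:R^-1 :> R by rewrite invr_gt0.
have /choice[y hy] (k : nat) : exists y, S y /\
    `|x k%:R - y| < dist_set (x k%:R) S + k.+1%:R^-1.
  by have [y Sy hy] := dist_set_adherent (x k%:R) S0 (n0 k); exists y.
have [|k|k|p Sp hp] := @argmin_cluster (fun k => k%:R) y M.
- by [].
- by apply: SM; have [] := hy k.
- apply: (@le_trans _ _ (vsup k%:R)).
    by apply: ereal_sup_ubound; exists (y k) => //; have [] := hy k.
  by rewrite leeDl// lee_fin ltW.
exists p => // e N e0; have e30 : 0 < e / 3 by rewrite divr_gt0.
have [T [Tr hT]] := (cvgrPdist_lt _ _).1 dist0 _ e30.
have [N1 _ hN1] : \forall k \near \oo, k.+1%:R^-1 < e / 3 :> R.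
  exact: (cvgr_lt 0 (@cvg_harmonic R)).
have [N2 _ hN2] : \forall k \near \oo, T + 1 <= k%:R.
  exact: nbhs_infty_ger.
have [k] := hp _ (maxn N (maxn N1 N2)) e30.
rewrite !geq_max => /and3P[Nk /hN1 /= k1 /hN2 /= k2] ykp; exists k => //.
have : dist_set (x k%:R) S < e / 3.
  have Tk : T < k%:R by lra.
  by have := hT _ Tk; rewrite sub0r normrN ger0_norm// dist_set_ge0.
have [_] := hy k; have := ler_normD (x k%:R - y k) (y k - p).
by rewrite addrA subrK; move: k1; move: (k.+1%:R^-1) => c; lra.
Qed.

End Gap.

(** * Attraction by the limit minimizers *)

Section Trajectory.
Set Implicit Arguments.
Unset Strict Implicit.
Local Open Scope ring_scope.
Context {R : realType} {H : completeNormedModType R}.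
Implicit Types (x : R -> H) (S : set H).

Lemma absolutely_continuous_on_sub (a a' b b' : R) x : a <= a' -> b' <= b ->
  absolutely_continuous_on a b x -> absolutely_continuous_on a' b' x.
Proof.
move=> aa' bb' acx e e0; have [d d0 hd] := acx e e0; exists d => // n u v uv.
apply: hd => i; have [h1 h2 h3] := uv i.
by split => //; [exact: le_trans h1|exact: le_trans bb'].
Qed.

Lemma absolutely_continuous_on_uniform (a b : R) x :
  absolutely_continuous_on a b x -> forall e : R, 0 < e -> exists2 d, 0 < d &
    forall u v, a <= u -> u <= v -> v <= b -> v - u < d -> `|x v - x u| < e.
Proof.
move=> acx e e0; have [d d0 hd] := absolutely_continuous_on_seq acx e0.
exists d => // u v au uv vb uvd.
have := hd [:: (u, v)]; rewrite !big_seq1; apply => //=.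
by rewrite /within_itv/= au uv vb.
Qed.

Lemma absolutely_continuous_on_bounded (a b : R) x : a <= b ->
  absolutely_continuous_on a b x ->
  exists B : R, forall t, a <= t -> t <= b -> `|x t| <= B.
Proof.
move=> ab acx.
have [d d0 hd] := absolutely_continuous_on_uniform acx ltr01.
pose P s := exists B : R, forall t, a <= t -> t <= s -> `|x t| <= B.
apply: (@real_induction _ a b P) => //.
  by exists `|x a| => t at_ ta; have -> : t = a by apply/eqP; rewrite eq_le ta.
move=> t /andP[at_ tb]; exists (d / 2); first exact: divr_gt0.
move=> s s' as_ ts st ts' s't s'b [B hB]; exists (B + 1) => u au us'.
have [us|su] := leP u s; first by have := hB u au us; lra.
have us1 : `|x u - x s| < 1 by apply: hd; lra.
have := hB s as_ (lexx _).
have := ler_normD (x u - x s) (x s); rewrite subrK; lra.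
Qed.

Lemma dist_set_sqr_lipschitz S x (B : R) p u v : S p ->
  `|x u| <= B -> `|x v| <= B ->
  dist_set (x v) S ^+ 2 - dist_set (x u) S ^+ 2 <=
  (2 * (B + `|p|)) * `|x v - x u|.
Proof.
move=> Sp uB vB; have S0 : S !=set0 by exists p.
have h1 := dist_set_lipschitz (x v) (x u) S0.
have hu := dist_set_le (x u) Sp; have hv := dist_set_le (x v) Sp.
have hu' := ler_normB (x u) p; have hv' := ler_normB (x v) p.
have := dist_set_ge0 (x u) S0; have := dist_set_ge0 (x v) S0.
set Du := dist_set (x u) S in h1 hu *; set Dv := dist_set (x v) S in h1 hv *.
move=> Dv0 Du0; have n0 := normr_ge0 (x v - x u).
have h3 : Dv + Du <= 2 * (B + `|p|) by lra.
have h4 : (Dv - Du) * (Dv + Du) <= `|x v - x u| * (Dv + Du).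
  by rewrite ler_wpM2r//; lra.
have h5 := ler_wpM2l n0 h3.
lra.
Qed.

End Trajectory.

Section Attraction.
Set Implicit Arguments.
Unset Strict Implicit.
Local Open Scope ring_scope.
Context {R : realType} {H : completeNormedModType R}.
Variable ip : {dot H for (@idfun R)}.
Hypothesis hH : induces_norm ip.
Implicit Types (x : R -> H) (S : set H).

(** The subgradient inequality at [y], tested at [p]. *)
Lemma subdifferential_descent (g : H -> \bar R) S (v d : R) (y w p : H) :
  (forall z, S z -> (g z <= v%:E)%E) -> (-oo < g y)%E ->
  (v%:E + d%:E <= g y)%E ->
  subdifferential ip g y (- w) -> S p -> ip w (y - p) <= - d.
Proof.
move=> gS gNy vdg [gfin /(_ p) h] /gS gp.
move: gNy vdg gfin h; case: (g y) => [r| |]// _ + _ => /[swap] h.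
rewrite -EFinD lee_fin; have := le_trans h gp.
rewrite -EFinD lee_fin ipNl -ipNr opprB; lra.
Qed.

(** As long as the trajectory is at distance at least [e] from [S] its squared
    distance to [S] decreases with slope [- 2 * d], so the distance becomes at most
    [e] at some time. Afterwards it stays so, because the maximum of the squared
    distance and [e ^+ 2] has nonpositive slope at almost every time. *)
Lemma dist_set_cvg0 (phi : R -> H -> \bar R) S x :
  (forall t : R, 0 <= t -> closed_convex (phi t)) ->
  S !=set0 -> bounded_set S ->
  strong_global_solution ip phi x ->
  (forall e : R, 0 < e -> exists d T : R, [/\ 0 < d, 0 <= T & forall t, T <= t ->
     ereal_sup [set phi t z | z in S] \is a fin_num /\
     forall y, e <= dist_set y S ->
       (ereal_sup [set phi t z | z in S] + d%:E <= phi t y)%E]) ->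
  dist_set (x t) S @[t --> +oo%R] --> (0 : R).
Proof.
move=> hphi S0 bS [acx aex] gap; have [p Sp] := S0.
have [M SM] := bounded_set_norm bS.
apply/cvgrPdist_le => e e0.
have aeF := ae_filter_ringOfSetsType (@lebesgue_measure R).
have [d [T [d0 T0 hT]]] := gap _ e0.
pose D s := dist_set (x s) S.
have D0 s : 0 <= D s by exact: dist_set_ge0.
have slopeD t : T < t -> derivable x t 1 ->
    subdifferential ip (phi t) (x t) (- derive1 x t) -> e <= D t ->
    slope_le (fun s => D s ^+ 2) t (- 2 * d).
  move=> Tt dx sx eD; have [vfin hgap] := hT _ (ltW Tt).
  have [hNy _ _] := hphi _ (le_trans T0 (ltW Tt)).
  rewrite mulNr -mulrN; apply: (slope_dist_set hH S0 SM dx) => q Sq.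
  apply: (@subdifferential_descent (phi t) S
    (fine (ereal_sup [set phi t z | z in S]))) => //.
  - by move=> z Sz; rewrite fineK//; apply: ereal_sup_ubound; exists z.
  - by rewrite ltNye.
  - by rewrite fineK//; exact: hgap.
have bounded_incr b : T <= b -> exists2 L, 0 <= L &
    forall u v, T <= u -> u <= v -> v <= b ->
      D v ^+ 2 - D u ^+ 2 <= L * `|x v - x u|.
  move=> Tb; have b0 := le_trans T0 Tb.
  have [B hB] := absolutely_continuous_on_bounded b0 (acx b b0).
  exists (2 * (B + `|p|)).
    by move: (hB 0 (lexx _) b0) (normr_ge0 (x 0)) (normr_ge0 p); lra.
  move=> u v Tu uv vb; apply: dist_set_sqr_lipschitz => //; apply: hB; lra.
have acT b : T <= b -> absolutely_continuous_on T b x.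
  move=> Tb; apply: (absolutely_continuous_on_sub T0 (lexx b)).
  exact: acx _ (le_trans T0 Tb).
have [t1 Tt1 Dt1] : exists2 t1, T <= t1 & D t1 <= e.
  apply: contrapT => far.
  have {}far t : T <= t -> e < D t.
    by move=> Tt; rewrite ltNge; apply/negP => Dt; apply: far; exists t.
  (* A time at which the decrease would have made the square negative. *)
  pose b := T + (D T ^+ 2 + 1) / (2 * d).
  have d20 : 0 < 2 * d by rewrite mulr_gt0.
  have DT1 : 0 < D T ^+ 2 + 1 by have := sqr_ge0 (D T); lra.
  have Tb : T <= b by rewrite lerDl ltW// divr_gt0.
  have [L L0 hL] := bounded_incr b Tb.
  have : D b ^+ 2 + 2 * d * b <= D T ^+ 2 + 2 * d * T.
    apply: (@nonincreasing_of_slope R H T b (2 * d) L x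
      (fun s => D s ^+ 2 + 2 * d * s) Tb (acT b Tb) (ltW d20) L0).
    - by move=> u v Tu uv vb; have := hL u v Tu uv vb; lra.
    - apply: filterS aex => t ht /andP[Tt tb] e' e'0.
      have [dx sx] := ht (le_lt_trans T0 Tt).
      near=> s.
      have : (s - t) * (D s ^+ 2 - D t ^+ 2) <= (- 2 * d + e') * (s - t) ^+ 2.
        by near: s; apply: slopeD => //; exact/ltW/far/ltW.
      lra.
  have : 2 * d * b = 2 * d * T + D T ^+ 2 + 1 by rewrite /b; field; lra.
  by have := sqr_ge0 (D b); lra.
near=> t.
have tt1 : t1 <= t by near: t; apply: nbhs_pinfty_ge; rewrite num_real.
rewrite sub0r normrN (ger0_norm (D0 t)) -ler_sqr ?nnegrE ?(ltW e0)//.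
have Tt : T <= t by exact: le_trans tt1.
have [L L0 hL] := bounded_incr t Tt.
pose F s := Num.max (D s ^+ 2) (e ^+ 2).
have e20 : 0 < e ^+ 2 by rewrite exprn_gt0.
suff : F t <= F t1.
  have F1 : D t1 ^+ 2 <= e ^+ 2 by rewrite ler_sqr ?nnegrE// ltW.
  by rewrite /F (max_idPr F1) ge_max => /andP[].
apply: (@nonincreasing_of_slope R H t1 t 0 L x F) => //.
- exact: absolutely_continuous_on_sub Tt1 (lexx t) (acT t Tt).
- move=> u v t1u uv vt; rewrite mul0r add0r.
  have := hL u v (le_trans Tt1 t1u) uv vt.
  have Lx : 0 <= L * `|x v - x u| by rewrite mulr_ge0.
  by rewrite /F /Num.max /Order.max; do 2 case: ifPn; rewrite -?leNgt; lra.
- apply: filterS aex => s hs /andP[t1s st] e' e'0.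
  have Ts := le_lt_trans Tt1 t1s.
  have [dx sx] := hs (le_lt_trans T0 Ts).
  have [eD|De] := leP e (D s).
    near=> s'.
    have : (s' - s) * (D s' ^+ 2 - D s ^+ 2) <= (- 2 * d + e') * (s' - s) ^+ 2.
      by near: s'; exact: slopeD.
    have Fs : F s = D s ^+ 2 by apply/max_idPl; rewrite ler_sqr ?nnegrE// ltW.
    have ds : 0 <= d * (s' - s) ^+ 2 by rewrite mulr_ge0 ?sqr_ge0 ?ltW.
    have es : 0 <= e' * (s' - s) ^+ 2 by rewrite mulr_ge0 ?sqr_ge0 ?ltW.
    have eDs : e ^+ 2 <= D s ^+ 2 by rewrite -Fs /F le_max lexx orbT.
    rewrite Fs add0r; have [s's|ss'] := ltP 0 (s' - s).
      by rewrite /F /Num.max /Order.max; case: ifPn => _; nra.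
    have : D s' ^+ 2 <= F s' by rewrite le_max lexx.
    nra.
  have : \forall s' \near s, `|x s - x s'| < e - D s.
    have /derivable1_diffP/differentiable_continuous cx := dx.
    by apply: (cvgr_dist_lt _ _ cx); rewrite subr_gt0.
  apply: filterS => s' hs'.
  have Ds' : D s' <= e.
    have := dist_set_lipschitz (x s') (x s) S0; rewrite -/(D s') -/(D s) distrC; lra.
  have Fe r : D r <= e -> F r = e ^+ 2.
    by move=> Dr; apply/max_idPr; rewrite ler_sqr ?nnegrE// ltW.
  by rewrite (Fe _ Ds') (Fe _ (ltW De)) subrr mulr0 add0r mulr_ge0 ?sqr_ge0// ltW.
Unshelve. all: by end_near. Qed.

End Attraction.

(** * Integrals of dominated functions and their primitives *)

Section LowerIntegral.
Set Implicit Arguments.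
Unset Strict Implicit.
Local Open Scope ring_scope.
Context {R : realType}.
Local Notation mu := (@lebesgue_measure R).
Import HBNNSimple.

(** [G] need not be measurable, and then its integral is the difference of the
    suprema of the integrals of the simple functions below its positive and its
    negative part. As [G] is nonnegative outside a null set, the simple functions
    below the negative part vanish almost everywhere, so that the integral
    dominates that of every measurable function below the positive part. *)
Lemma integral_lt_pinfty_dominated (G : R -> \bar R) (w : R -> R) (D A : set R) :
  measurable D -> measurable A -> mu A = 0%E ->
  (forall t, 0 <= w t) -> (forall t, A t \/ ~ D t -> w t = 0) ->
  (forall t, D t -> ~ A t -> ((w t)%:E <= G t)%E) ->
  (\int[mu]_(t in D) G t < +oo)%E ->
  (\int[mu]_t (w t)%:E < +oo)%E.
Proof.
move=> mD mA A0 w0 wA wG; rewrite /integral.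
set Gp := ereal_sup _; set Gm := ereal_sup _.
have Gm0 : Gm = 0%E.
  apply/eqP; rewrite eq_le; apply/andP; split; last first.
    apply: ereal_sup_ubound.
    by exists nnsfun0; [exact: funeneg_ge0|exact: sintegral0].
  apply: ge_ereal_sup => _ [h /= hG <-].
  have hA t : ~ A t -> h t = 0.
    move=> At; apply/eqP; rewrite eq_le fun_ge0 andbT -lee_fin.
    apply: (le_trans (hG t)); rewrite /= funenegE ge_max lexx andbT leeNl oppe0.
    rewrite patchE; case: ifPn => //; rewrite inE => Dt.
    by apply: le_trans (wG _ Dt At); rewrite lee_fin.
  have -> : sintegral mu h = (\int[mu]_t (h t)%:E)%E.
    by rewrite integral_nnsfun// patch_setT.
  rewrite (@ge0_ae_eq_integral _ _ _ mu setT _ (cst 0%E))//.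
  - by rewrite integral0.
  - exact/measurable_EFinP.
  - by move=> t _; rewrite lee_fin.
  - exists A; split => // t /= ht; apply: contrapT => At; apply: ht => _.
    by rewrite hA.
rewrite Gm0 sube0; apply: le_lt_trans.
rewrite -/(integral mu setT (fun t => (w t)%:E)) ge0_integralTE; last first.
  by move=> t; rewrite lee_fin.
apply: ge_ereal_sup => _ [h /= hw <-]; apply: ereal_sup_ubound; exists h => // t /=.
apply: (le_trans (hw t)); rewrite funeposE le_max patchE.
have [At|At] := pselect (A t); first by rewrite wA ?lexx ?orbT//; left.
case: ifPn => [|/negP Dt]; first by rewrite inE => Dt; rewrite wG.
by rewrite wA ?lexx//; right => Dt'; apply: Dt; rewrite inE.
Qed.

End LowerIntegral.

Section Primitive.
Set Implicit Arguments.
Unset Strict Implicit.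
Local Open Scope ring_scope.
Context {R : realType}.
Local Notation mu := (@lebesgue_measure R).
Variable w : R -> R.
Hypotheses (mw : measurable_fun setT w) (w0 : forall t, 0 <= w t).
Hypothesis wfin : (\int[mu]_t (w t)%:E < +oo)%E.

Definition primitive s := (\int[mu]_(t in `]-oo, s]) w t)%R.

Lemma integrable_primitive : mu.-integrable setT (EFin \o w).
Proof.
apply/integrableP; split; first exact/measurable_EFinP.
by under eq_integral => t _ do rewrite /= ger0_norm//.
Qed.

Let fin_integral s : (\int[mu]_(t in `]-oo, s]) (w t)%:E)%E \is a fin_num.
Proof.
apply: integrable_fin_num => //.
by apply: integrableS integrable_primitive.
Qed.

Lemma primitive_nondecreasing u v : u <= v -> primitive u <= primitive v.
Proof.
move=> uv; apply: fine_le => //; apply: ge0_subset_integral => //.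
- by apply/measurable_EFinP; exact: measurable_funS mw.
- by move=> t _; rewrite lee_fin.
- by move=> t /=; rewrite !in_itv/= => /le_trans; apply.
Qed.

Lemma primitive_bounded : has_ubound (range primitive).
Proof.
exists (fine (\int[mu]_t (w t)%:E)) => _ [s _ <-]; apply: fine_le => //.
  exact: integrable_fin_num integrable_primitive.
apply: ge0_subset_integral => //; first exact/measurable_EFinP.
by move=> t _; rewrite lee_fin.
Qed.

Lemma primitive_derivable : {ae mu, forall t, derivable primitive t 1 /\
  derive1 primitive t = w t}.
Proof.
apply: FTC1Ny; first by move=> y; apply: integrableS integrable_primitive.
exact: open_integrable_locally openT integrable_primitive.
Qed.

Lemma primitive_cauchy (e : R) : 0 < e -> exists a0, forall a b,
  a0 <= a -> a <= b -> primitive b - primitive a <= e.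
Proof.
move=> e0.
have hs : has_sup (range primitive).
  by split; [exists (primitive 0), 0|exact: primitive_bounded].
have [_ [a0 _ <-] ha] := sup_adherent e0 hs; exists a0 => a b a0a ab.
have := primitive_nondecreasing a0a.
have : primitive b <= sup (range primitive) by apply: (ub_le_sup hs.2); exists b.
lra.
Qed.

End Primitive.

(** * Convergence of the trajectory *)

Section Energy.
Set Implicit Arguments.
Unset Strict Implicit.
Local Open Scope ring_scope.
Context {R : realType} {H : completeNormedModType R}.
Variable ip : {dot H for (@idfun R)}.
Hypothesis hH : induces_norm ip.
Local Notation mu := (@lebesgue_measure R).
Implicit Types (x : R -> H) (z : H).

(** The trajectory is only continuous on the half line; extended by its initial
    value it is continuous on the whole line, hence measurable when composed with
    norms. *)
Lemma absolutely_continuous_extension x :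
  (forall T, 0 <= T -> absolutely_continuous_on 0 T x) ->
  continuous (fun t : R => x (Num.max 0 t)).
Proof.
move=> acx t; apply/cvgrPdist_lt => e e0.
have m0 (s : R) : 0 <= Num.max 0 s by rewrite le_max lexx.
have b0 : 0 <= Num.max 0 t + 1 by have := m0 t; lra.
have [d d0 hd] := absolutely_continuous_on_uniform (acx _ b0) e0.
have md : 0 < Num.min d 1 by rewrite lt_min d0 ltr01.
apply/nbhs_ballP; exists (Num.min d 1) => // s /=.
rewrite /ball/= lt_min => /andP[sd s1].
have : `|Num.max 0 t - Num.max 0 s| <= `|t - s|.
  by rewrite /Num.max /Order.max; do 2 case: ifPn; rewrite -?leNgt => *;
    rewrite ler_norml; apply/andP; split; have := ler_norm (t - s);
    have := ler_norm (s - t); rewrite (distrC s t); lra.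
move: (m0 t) (m0 s) b0 hd; set u := Num.max 0 t; set v := Num.max 0 s.
move=> u0 v0 b0 hd uv; have {}uv1 := le_lt_trans uv s1.
have {}uvd := le_lt_trans uv sd.
move: uvd uv1; rewrite !ltr_norml => /andP[h1 h2] /andP[h3 h4].
have [vu|uv'] := leP v u; first by apply: hd; lra.
by rewrite distrC; apply: hd; lra.
Qed.

Lemma cvg_difference_quotient x z (t : R) : derivable x t 1 ->
  n.+1%:R * (2^-1 * `|x (t + n.+1%:R^-1) - z| ^+ 2 - 2^-1 * `|x t - z| ^+ 2)
    @[n --> \oo] --> ip (derive1 x t) (x t - z).
Proof.
move=> dx; pose q (n : nat) := n.+1%:R *: (x (t + n.+1%:R^-1) - x t).
have n0 n : n.+1%:R != 0 :> R by rewrite pnatr_eq0.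
have cq : q n @[n --> \oo] --> derive1 x t.
  apply/cvgrPdist_le => e e0.
  have cs : t + n.+1%:R^-1 @[n --> \oo] --> t + 0.
    by apply: cvgD; [exact: cvg_cst|exact: cvg_harmonic].
  rewrite addr0 in cs.
  have hn := cs _ (derivable_near dx e0); near=> n.
  have : `|x (t + n.+1%:R^-1) - x t - (t + n.+1%:R^-1 - t) *: derive1 x t| <=
      e * `|t + n.+1%:R^-1 - t| by near: n.
  have -> : t + n.+1%:R^-1 - t = n.+1%:R^-1 by rewrite addrAC subrr add0r.
  move=> h; rewrite distrC.
  have -> : q n - derive1 x t = n.+1%:R *:
      (x (t + n.+1%:R^-1) - x t - n.+1%:R^-1 *: derive1 x t).
    by rewrite scalerBr scalerA divff// scale1r.
  rewrite normrZ ger0_norm//; apply: (le_trans (ler_wpM2l (ler0n _ _) h)).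
  by rewrite [`|_|]ger0_norm ?invr_ge0// mulrCA divff// mulr1.
have E n : n.+1%:R *
      (2^-1 * `|x (t + n.+1%:R^-1) - z| ^+ 2 - 2^-1 * `|x t - z| ^+ 2) =
    ip (q n) (x t - z) + 2^-1 * (n.+1%:R^-1 * (`|q n| * `|q n|)).
  have -> : x (t + n.+1%:R^-1) - z = n.+1%:R^-1 *: q n + (x t - z).
    by rewrite /q scalerA mulVf// scale1r addrA subrK.
  have i0 : 0 <= n.+1%:R^-1 :> R by rewrite invr_ge0.
  rewrite (normD_sqr hH (n.+1%:R^-1 *: q n)) ipZl (normrZ n.+1%:R^-1) (ger0_norm i0).
  by move: (n0 n); move: (n.+1%:R) => N N0; field.
under eq_fun do rewrite E.
have -> : ip (derive1 x t) (x t - z) =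
    ip (derive1 x t) (x t - z) + 2^-1 * (0 * (`|derive1 x t| * `|derive1 x t|)).
  by rewrite mul0r mulr0 addr0.
apply: cvgD; first by apply: (cvg_ip hH) => //; exact: cvg_cst.
apply: cvgMr; apply: cvgM; first exact: cvg_harmonic.
by apply: cvgM; exact: cvg_norm.
Unshelve. all: by end_near. Qed.

(** Almost everywhere half the derivative of [`|x t - z| ^+ 2] is
    [ip (derive1 x t) (x t - z)], one of the numbers whose supremum is the
    Brezis-Haraux function at [(z, 0)]. Its positive part [w] is therefore
    integrable; subtracting twice a primitive of [w] from [`|x t - z| ^+ 2] leaves
    a function of nonpositive slope, while the primitive has small increments at
    large times. *)
Lemma distance_almost_nonincreasing (phi : R -> H -> \bar R) x z :
  (forall t : R, 0 <= t -> closed_convex (phi t)) ->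
  strong_global_solution ip phi x ->
  (\int[mu]_(t in `[0%R, +oo[)
     brezis_haraux ip (subdifferential ip (phi t)) z 0%R < +oo)%E ->
  forall e : R, 0 < e -> exists a0 : R, forall a b, a0 <= a -> a <= b ->
    `|x b - z| ^+ 2 <= `|x a - z| ^+ 2 + e.
Proof.
move=> hphi [acx [A1 [mA1 A10 bad]]] Gfin e e0.
pose A := A1 `|` [set 0].
have mA : measurable A by exact: measurableU.
have A0 : mu A = 0%E by rewrite measureU0//; exact: lebesgue_measure_set1.
have good t : 0 <= t -> ~ A t -> [/\ 0 < t, derivable x t 1 &
    subdifferential ip (phi t) (x t) (- derive1 x t)].
  move=> t0 At; have {}t0 : 0 < t.
    by rewrite lt_neqAle t0 andbT; apply/eqP => t00; apply: At; right.
  have : ~ A1 t by move=> A1t; apply: At; left.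
  move=> A1t; have : ~ ~ (0 < t -> derivable x t 1 /\
      subdifferential ip (phi t) (x t) (- derive1 x t)).
    by move=> h; apply: A1t; exact: bad.
  by move=> /contrapT/(_ t0)[].
pose y t := x (Num.max 0 t).
have cy : continuous y by exact: absolutely_continuous_extension.
pose F t : R := 2^-1 * `|y t - z| ^+ 2.
have cF : continuous F.
  move=> t; apply: cvgMr; rewrite /= expr2; under eq_fun do rewrite expr2.
  by apply: cvgM; apply: cvg_norm; apply: cvgB;
    [exact: cy|exact: cvg_cst|exact: cy|exact: cvg_cst].
have mF : measurable_fun setT F by exact: continuous_measurable_fun.
(* The upper limit makes [dF] measurable whether or not [F] is derivable. *)
pose dF t := limn_esup (fun n => (n.+1%:R * (F (t + n.+1%:R^-1) - F t))%:E).
have mdF : measurable_fun setT dF.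
  apply: measurable_fun_limn_esup => n; apply/measurable_EFinP.
  apply: measurable_funM => //; apply: measurable_funB => //.
  apply: measurableT_comp => //; exact: measurable_funD.
have dFE t : 0 < t -> derivable x t 1 -> dF t = (ip (derive1 x t) (x t - z))%:E.
  move=> t0 dx; apply: (cvg_limn_einf_sup _).2; apply: cvg_EFin.
    exact: nearW.
  have := cvg_difference_quotient (z := z) dx; apply: cvg_trans.
  apply: near_eq_cvg; apply: nearW => n /=.
  rewrite /F /y (max_idPr (ltW t0)) (max_idPr _)// addr_ge0 ?invr_ge0//.
  exact: ltW.
pose w : R -> R :=
  (fun t => Num.max 0 (fine (dF t))) \* \1_(`[0, +oo[%classic `\` A).
have mw : measurable_fun setT w.
  apply: measurable_funM.
    apply: measurable_maxr => //; apply: measurableT_comp mdF.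
    exact: fine_measurable.
  by apply: measurable_indic; exact: measurableD.
have w0 t : 0 <= w t by rewrite mulr_ge0// le_max lexx.
have wE t : 0 <= t -> ~ A t -> w t = Num.max 0 (ip (derive1 x t) (x t - z)).
  move=> t0 At; have [t0' dx _] := good _ t0 At.
  rewrite /w /= dFE// indicE mem_set ?mulr1//=.
  by split => //; rewrite /= in_itv/= t0.
have wfin : (\int[mu]_t (w t)%:E < +oo)%E.
  apply: (integral_lt_pinfty_dominated _ mA A0 w0 _ _ Gfin) => //.
  - move=> t tA; rewrite /w /= indicE memNset ?mulr0//.
    by move=> [h1 h2]; case: tA.
  - move=> t; rewrite /= in_itv/= andbT => t0 At.
    have [_ _ sx] := good _ t0 At; rewrite wE//.
    rewrite EFin_max ge_max; apply/andP; split.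
      exact: brezis_haraux_subdifferential_ge0 (hphi _ t0) sx.
    apply: ereal_sup_ubound; exists (x t, - derive1 x t) => //=.
    by rewrite subr0 ipC// ipNl -ipNr opprB.
have [a0 ha0] := primitive_cauchy mw w0 wfin (divr_gt0 e0 (ltr0n _ 2)).
exists (Num.max 0 a0) => a b; rewrite ge_max => /andP[a0' a0a] ab.
have b0 := le_trans a0' ab.
have [B hB] := absolutely_continuous_on_bounded b0 (acx b b0).
pose W := primitive w.
suff : `|x b - z| ^+ 2 - 2 * W b <= `|x a - z| ^+ 2 - 2 * W a.
  have := ha0 _ _ a0a ab; rewrite -/W; lra.
have B0 : 0 <= B by exact: le_trans (normr_ge0 _) (hB 0 (lexx _) b0).
apply: (@nonincreasing_of_slope R H a b 0 (2 * (B + `|z|)) x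
  (fun s => `|x s - z| ^+ 2 - 2 * W s)) => //.
- exact: absolutely_continuous_on_sub a0' (lexx b) (acx b b0).
- by rewrite mulr_ge0// addr_ge0.
- move=> u v au uv vb; rewrite mul0r add0r.
  have uB : `|x u| <= B by apply: hB; lra.
  have vB : `|x v| <= B by apply: hB; lra.
  have := @dist_set_sqr_lipschitz R H [set z] x B z u v erefl uB vB.
  rewrite !dist_set1.
  have := primitive_nondecreasing mw w0 wfin uv; rewrite -/W; lra.
- have aeA : {ae mu, forall t, ~ A t}.
    by exists A; split => // t /= /contrapT.
  have aeF := ae_filter_ringOfSetsType mu.
  apply: filterS (filterI (primitive_derivable mw w0 wfin) aeA).
  move=> t [[dW dWE] At] /andP[at_ tb].
  have t0 := le_trans a0' (ltW at_).
  have [_ dx _] := good _ t0 At.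
  have -> : 0 = 2 * w t - 2 * derive1 W t by rewrite /W dWE subrr.
  apply: slope_leB => //.
  under eq_fun do rewrite -dist_set1.
  apply: (slope_dist_set hH) => //; [by exists z|by move=> p ->|].
  by move=> p ->; rewrite wE// le_max lexx orbT.
Qed.

(** An accumulation point [p] whose distance to the trajectory almost decreases is
    its limit. *)
Lemma cvg_pinfty_of_cluster x (p : H) :
  (forall e : R, 0 < e -> exists a0 : R, forall a b, a0 <= a -> a <= b ->
    `|x b - p| ^+ 2 <= `|x a - p| ^+ 2 + e) ->
  (forall (e : R) N, 0 < e -> exists2 k, (N <= k)%N & `|x k%:R - p| < e) ->
  x t @[t --> +oo] --> p.
Proof.
move=> dec clus; apply/cvgrPdist_lt => e e0.
have e20 : 0 < e ^+ 2 / 2 by rewrite divr_gt0// exprn_gt0.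
have [a0 ha0] := dec _ e20.
have [N _ hN] : \forall k \near \oo, a0 <= k%:R by exact: nbhs_infty_ger.
have [k /hN/= ak xkp] := clus _ N (divr_gt0 e0 (ltr0n _ 2)).
near=> t.
have kt : k%:R <= t by near: t; apply: nbhs_pinfty_ge; rewrite num_real.
have h := ha0 _ _ ak kt.
rewrite distrC -ltr_sqr ?nnegrE ?(ltW e0)//.
have : `|x k%:R - p| ^+ 2 < (e / 2) ^+ 2.
  by rewrite ltr_sqr ?nnegrE// ltW// divr_gt0.
have : 0 < e ^+ 2 by rewrite exprn_gt0.
lra.
Unshelve. all: by end_near. Qed.

End Energy.

Theorem theorem3p2 (R : realType) (H : completeNormedModType R)
  (ip : {dot H for (@idfun R)}) (hH : induces_norm ip)
  (phi : R -> H -> \bar R)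
  (hphi : forall t : R, (0 <= t)%R -> closed_convex (phi t))
  (phi_inf : H -> \bar R)
  (hphi_inf : closed_convex phi_inf /\ eproper phi_inf)
  (H1 : argmin phi_inf !=set0 /\ bounded_set (argmin phi_inf))
  (H2 : forall (t : nat -> R) (xs : nat -> H) (x_inf : H),
     (forall k, (0 <= t k)%R) ->
     t k @[k --> \oo] --> +oo%R ->
     xs k @[k --> \oo] --> x_inf ->
     phi_inf x_inf <= limn_einf (fun k => phi (t k) (xs k)))
  (H3 : ereal_sup [set phi t z | z in argmin phi_inf] @[t --> +oo%R]
          --> ereal_inf (range phi_inf))
  (H4 : exists (t0 : R) (f : H -> \bar R),
     [/\ (0 <= t0)%R,
         forall r l : R, (0 < r)%R ->
           precompact [set x : H | (`|x| <= r)%R /\ f x <= l%:E]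
       & forall t : R, (t0 <= t)%R -> forall x : H, f x <= phi t x])
  (x : R -> H) (hx : strong_global_solution ip phi x) :
  (dist_set (x t) (argmin phi_inf) @[t --> +oo%R] --> (0 : R)%R) /\
  ((forall z : H, argmin phi_inf z ->
      \int[@lebesgue_measure R]_(t in `[0%R, +oo[)
        brezis_haraux ip (subdifferential ip (phi t)) z 0%R < +oo) ->
   exists2 x_inf : H, argmin phi_inf x_inf & weakly_cvg_pinfty ip x x_inf).
Proof.
have [S0 bS] := H1.
have gap := uniform_gap hphi hphi_inf S0 H2 H3 H4 bS.
have dist0 := dist_set_cvg0 hH hphi S0 bS hx gap.
split => // Gfin.
have [p Sp clus] := trajectory_cluster hphi_inf S0 H2 H3 H4 bS dist0.
exists p => // y; apply: (cvg_ip hH); last exact: cvg_cst.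
apply: cvg_pinfty_of_cluster clus.
exact: (distance_almost_nonincreasing hH hphi hx (Gfin p Sp)).
Qed.
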